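(* For all $i\geq 1$, $\mathbf{V}(S_{\mathbb{F}_i})=\mathbf{V}(S_{\mathbb{B}_1})$, where $\mathbb{F}_i$ is the $i$-th fan-type 3-hypergraph and $\mathbb{B}_1$ is the 3-cycle 3-hypergraph (triangle).
   Context: A 3-uniform hypergraph $\mathbb{H}=(V,E)$ has a finite vertex set $V$ and a set $E$ of 3-element subsets of $V$ (hyperedges). All hypergraphs considered are linear (any two distinct hyperedges share at most one vertex) and every vertex lies in some hyperedge. A subhyperedge is a nonempty subset of a hyperedge. Two subhyperedges $e_1',e_2'$ are linked if there is a single vertex $w\notin e_1'\cup e_2'$ such that $e_1'\cup\{w\}$ and $e_2'\cup\{w\}$ are both hyperedges. The 3-hypergraph semigroup of $\mathbb{H}$ is the semigroup given by the presentation with generators $\mathbf{a}_u$ ($u\in V$) and $0$, and relations: $\mathbf{a}_u\mathbf{a}_v=\mathbf{a}_v\mathbf{a}_u$; $0\mathbf{a}_u=\mathbf{a}_u0=00=0$; $\mathbf{a}_u\mathbf{a}_v=0$ if $u=v$ or $\{u,v\}$ is not a subhyperedge; $\mathbf{a}_u\mathbf{a}_v\mathbf{a}_h=0$ if $\{u,v,h\}\notin E$; $\mathbf{a}_{u_i}\mathbf{a}_{u_j}=\mathbf{a}_{u_r}\mathbf{a}_{u_l}$ if $\{u_i,u_j\}$ and $\{u_r,u_l\}$ are linked; and for every hyperedge $\{u,v,w\}$, $\mathbf{a}_u\mathbf{a}_v\mathbf{a}_w=\mathbf{a}$, where $\mathbf{a}$ is one and the same (nonzero) element for all hyperedges. This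 semigroup with zero is 0-cancellative, and therefore becomes a semiring $S_{\mathbb{H}}$, called the 3-hypergraph semiring of $\mathbb{H}$, under the flat addition $x+x=x$ and $x+y=0$ for $x\ne y$. Fan-type 3-hypergraphs: for $i\ge1$, $\mathbb{F}_i$ is an (open) fan of $i$ triangles sharing a common apex. It has $3i+3$ pairwise distinct vertices: the apex $c$, rim corners $r_0,\dots,r_i$, spoke midpoints $s_0,\dots,s_i$, and rim midpoints $t_1,\dots,t_i$; its $2i+1$ hyperedges are $\{c,s_j,r_j\}$ for $0\le j\le i$ and $\{r_{j-1},t_j,r_j\}$ for $1\le j\le i$. $\mathbb{B}_1$ has 6 vertices $u_1,\dots,u_6$ and hyperedges $\{u_1,u_2,u_3\},\{u_3,u_4,u_5\},\{u_5,u_6,u_1\}$. $\mathbf{V}(S)$ denotes the variety generated by the semiring $S$, in the signature $\{+,\cdot\}$ (both operations associative, $+$ commutative, $\cdot$ distributing over $+$ on both sides). *)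

(* Defs.v *)
From HB Require Import structures.
From mathcomp Require Import all_boot.
From mathcomp Require Import generic_quotient boolp.
From mathcomp Require Import zify.

Set Implicit Arguments.
Unset Strict Implicit.
Unset Printing Implicit Defensive.

Local Open Scope group_scope.

(** * Semirings and varieties *)

Record semiring : Type := Semiring {
  scarrier :> Type;
  sadd : scarrier -> scarrier -> scarrier;
  smul : scarrier -> scarrier -> scarrier;
  s_inhabited : inhabited scarrier;
  saddA : associative sadd;
  saddC : commutative sadd;
  smulA : associative smul;
  smulDl : left_distributive smul sadd;
  smulDr : right_distributive smul sadd
}.

Definition semiring_hom (S T : semiring) (f : S -> T) : Prop :=
  {morph f : x y / sadd x y} /\ {morph f : x y / smul x y}.

Section Product.
Variables (I : Type) (S : I -> semiring).

Let carrier := forall i, S i.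
Let add (x y : carrier) : carrier := fun i => sadd (x i) (y i).
Let mul (x y : carrier) : carrier := fun i => smul (x i) (y i).

Lemma product_inhabited : inhabited carrier.
Proof.
suff h i : exists x : S i, True by exact: inhabits (fun i => projT1 (cid (h i))).
by have [x] := s_inhabited (S i); exists x.
Qed.

Lemma product_addA : associative add.
Proof. by move=> x y z; apply: functional_extensionality_dep => i; exact: saddA. Qed.

Lemma product_addC : commutative add.
Proof. by move=> x y; apply: functional_extensionality_dep => i; exact: saddC. Qed.

Lemma product_mulA : associative mul.
Proof. by move=> x y z; apply: functional_extensionality_dep => i; exact: smulA. Qed.

Lemma product_mulDl : left_distributive mul add.
Proof. by move=> x y z; apply: functional_extensionality_dep => i; exact: smulDl. Qed.

Lemma product_mulDr : right_distributive mul add.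
Proof. by move=> x y z; apply: functional_extensionality_dep => i; exact: smulDr. Qed.

Definition product_semiring : semiring :=
  Semiring product_inhabited product_addA product_addC product_mulA
           product_mulDl product_mulDr.

End Product.

(* Subalgebras are taken up to isomorphism, as domains of injective
   homomorphisms. *)
Definition is_variety (K : semiring -> Prop) : Prop :=
  [/\ forall (S T : semiring) (f : S -> T),
        semiring_hom f -> (forall y, exists x, f x = y) -> K S -> K T,
      forall (S T : semiring) (f : S -> T),
        semiring_hom f -> injective f -> K T -> K S
    & forall (I : Type) (S : I -> semiring),
        (forall i, K (S i)) -> K (product_semiring S)].

(* [variety S] is the smallest variety containing S. It is a predicate rather
   than a [set semiring]: the universe constraints of [set] would clash with
   those of [semigroupType]. *)
Definition variety (S T : semiring) : Prop :=
  forall K : semiring -> Prop, is_variety K -> K S -> K T.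

(** * Flat semirings *)

Definition absorbing (S : semigroupType) (z : S) : Prop :=
  forall x : S, z * x = z /\ x * z = z.

Definition zero_cancellative (S : semigroupType) (z : S) : Prop :=
  (forall x y t : S, x * y = x * t -> x * y <> z -> y = t) /\
  (forall x y t : S, y * x = t * x -> y * x <> z -> y = t).

Section Flat.
Variables (S : semigroupType) (z : S).
Hypotheses (zS : absorbing z) (cS : zero_cancellative z).

Definition flat_add (x y : S) : S := if x == y then x else z.

Lemma flat_addA : associative flat_add.
Proof.
move=> x y t; rewrite /flat_add; have [->|nyt] := eqVneq y t.
  by have [->|nxt] := eqVneq x t; rewrite ?eqxx //; case: ifP.
transitivity z; first by case: eqP.
by have [->|nxy] := eqVneq x y; [rewrite (negPf nyt) | case: ifP].
Qed.

Lemma flat_addC : commutative flat_add.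
Proof. by move=> x y; rewrite /flat_add eq_sym; case: eqP => [->|]. Qed.

Lemma flat_mulDl : left_distributive (@mul S) flat_add.
Proof.
move=> x y t; rewrite /flat_add; have [->|nxy] := eqVneq x y.
  by rewrite eqxx.
rewrite (proj1 (zS t)); case: eqP => // e.
have [-> //|/eqP nz] := eqVneq (x * t) z.
by case/eqP: nxy; exact: (proj2 cS) e nz.
Qed.

Lemma flat_mulDr : right_distributive (@mul S) flat_add.
Proof.
move=> t x y; rewrite /flat_add; have [->|nxy] := eqVneq x y.
  by rewrite eqxx.
rewrite (proj2 (zS t)); case: eqP => // e.
have [-> //|/eqP nz] := eqVneq (t * x) z.
by case/eqP: nxy; exact: (proj1 cS) e nz.
Qed.

Definition flat_semiring : semiring :=
  Semiring (inhabits z) flat_addA flat_addC (@mulgA S) flat_mulDl flat_mulDr.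

End Flat.

(** * Semigroup presentations *)

(* The free semigroup: nonempty words, stored as (first letter, rest). *)
Definition word (A : choiceType) : Type := (A * seq A)%type.

Section Word.
Variable A : choiceType.

HB.instance Definition _ := Choice.on (word A).

Definition letter (x : A) : word A := (x, [::]).

Definition word_cat (u v : word A) : word A := (u.1, u.2 ++ v.1 :: v.2).

Lemma word_catA : associative word_cat.
Proof. by move=> u v w; rewrite /word_cat /= -catA. Qed.

HB.instance Definition _ := isSemigroup.Build (word A) word_catA.

End Word.

Section Presentation.
Variables (A : choiceType) (R : word A -> word A -> Prop).

Inductive congruence : word A -> word A -> Prop :=
| cong_rel u v : R u v -> congruence u v
| cong_refl u : congruence u u
| cong_sym u v : congruence u v -> congruence v u
| cong_trans u v w : congruence u v -> congruence v w -> congruence u w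
| cong_mul u u' v v' :
    congruence u u' -> congruence v v' -> congruence (u * v) (u' * v').

Definition congruenceb (u v : word A) : bool := `[< congruence u v >].

Lemma congruenceb_refl : reflexive congruenceb.
Proof. by move=> u; apply/asboolP; exact: cong_refl. Qed.

Lemma congruenceb_sym : symmetric congruenceb.
Proof. by move=> u v; apply/asboolP/asboolP; exact: cong_sym. Qed.

Lemma congruenceb_trans : transitive congruenceb.
Proof. by move=> v u w /asboolP uv /asboolP vw; apply/asboolP; exact: cong_trans uv vw. Qed.

Canonical congruence_equiv : equiv_rel (word A) :=
  EquivRel congruenceb congruenceb_refl congruenceb_sym congruenceb_trans.

Definition presented : Type := {eq_quot congruence_equiv}%qT.

HB.instance Definition _ := Choice.on presented.
HB.instance Definition _ := EqQuotient.on presented.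

Local Open Scope quotient_scope.

Lemma presented_eqP (u v : word A) :
  \pi_presented u = \pi_presented v <-> congruence u v.
Proof.
split=> [/(@eqquotP _ _ presented)/asboolP //|h].
by apply/(@eqquotP _ _ presented)/asboolP.
Qed.

Definition presented_mul (x y : presented) : presented :=
  \pi_presented (repr x * repr y).

Lemma presented_pi_mul (u v : word A) :
  presented_mul (\pi_presented u) (\pi_presented v) = \pi_presented (u * v).
Proof. by apply/presented_eqP/cong_mul; apply/presented_eqP; rewrite reprK. Qed.

Lemma presented_mulA : associative presented_mul.
Proof.
elim/(@quotW _ presented) => u; elim/(@quotW _ presented) => v.
elim/(@quotW _ presented) => w.
by rewrite !presented_pi_mul; congr pi; exact: mulgA.
Qed.

HB.instance Definition _ := isSemigroup.Build presented presented_mulA.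

Lemma piM (u v : word A) :
  \pi_presented (u * v) = \pi_presented u * \pi_presented v.
Proof. by rewrite -presented_pi_mul. Qed.

End Presentation.

(** * 3-hypergraphs and their semirings *)

Record hypergraph : Type := Hypergraph {
  vertex : finType;
  hyperedges : {set {set vertex}};
  hyperedge_card : forall e, e \in hyperedges -> #|e| = 3;
  hyperedge_linear : forall e f, e \in hyperedges -> f \in hyperedges ->
    e != f -> #|e :&: f| <= 1;
  vertex_covered : forall v, exists2 e, e \in hyperedges & v \in e
}.

Section HypergraphSemigroup.
Variable H : hypergraph.

Local Notation V := (vertex H).
Local Notation E := (hyperedges H).

Definition subhyperedge (s : {set V}) : Prop :=
  s <> set0 /\ exists2 e, e \in E & s \subset e.

Definition linked (s t : {set V}) : Prop :=
  [/\ subhyperedge s, subhyperedge t &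
      exists w, [/\ w \notin s :|: t, w |: s \in E & w |: t \in E]].

(* The generators are [Some u], standing for a_u, and [None], standing
   for 0. *)
Definition hgen (u : V) : word (option V) := letter (Some u).
Definition hzero : word (option V) := letter None.

Inductive hrel : word (option V) -> word (option V) -> Prop :=
| hrel_comm u v : hrel (hgen u * hgen v) (hgen v * hgen u)
| hrel_zerol u : hrel (hzero * hgen u) hzero
| hrel_zeror u : hrel (hgen u * hzero) hzero
| hrel_zero2 : hrel (hzero * hzero) hzero
| hrel_pair u v : u = v \/ ~ subhyperedge [set u; v] ->
    hrel (hgen u * hgen v) hzero
| hrel_triple u v h : [set u; v; h] \notin E ->
    hrel (hgen u * hgen v * hgen h) hzero
| hrel_linked ui uj ur ul : linked [set ui; uj] [set ur; ul] ->
    hrel (hgen ui * hgen uj) (hgen ur * hgen ul)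
| hrel_edge u v w u' v' w' : [set u; v; w] \in E -> [set u'; v'; w'] \in E ->
    hrel (hgen u * hgen v * hgen w) (hgen u' * hgen v' * hgen w').

Definition hypergraph_semigroup : semigroupType := presented hrel.

Definition hypergraph_zero : hypergraph_semigroup :=
  (\pi_(presented hrel) hzero)%qT.

Local Notation "u ~= v" := (congruence hrel u v) (at level 70).

(* The rest of this section proves that [hypergraph_semigroup] is
   0-cancellative, by identifying it with the model below: [MA u] is a_u,
   [MB w] is the common value of the products a_u a_v with {u, v, w} a
   hyperedge, and [MT] is the common value of the products along hyperedges. *)
Inductive model : Type := MZ | MA of V | MB of V | MT.

Definition third (u v : V) : option V := [pick w | [set u; v; w] \in E].

Definition mmul (x y : model) : model :=
  match x, y with
  | MA u, MA v => if third u v is Some w then MB w else MZ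
  | MA u, MB w => if u == w then MT else MZ
  | MB w, MA u => if u == w then MT else MZ
  | _, _ => MZ
  end.

Lemma edge_neq u v w : [set u; v; w] \in E -> [/\ u != v, u != w & v != w].
Proof.
move=> /hyperedge_card; rewrite setUC cardsU1 cards2 !inE.
rewrite negb_or ![w == _]eq_sym.
by case: eqP; case: eqP; case: eqP.
Qed.

Lemma edge_uniq u v w w' :
  [set u; v; w] \in E -> [set u; v; w'] \in E -> w = w'.
Proof.
move=> e1 e2; have [nuv nuw nvw] := edge_neq e1.
have [e12|/(hyperedge_linear e1 e2)] := eqVneq [set u; v; w] [set u; v; w'].
  have : w \in [set u; v; w'] by rewrite -e12 !inE eqxx orbT.
  by rewrite !inE ![w == _]eq_sym (negPf nuw) (negPf nvw) /= => /eqP.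
move/card_le1_eqP => /(_ u v); rewrite !inE !eqxx !orbT /=.
by move=> /(_ isT isT) uv; rewrite uv eqxx in nuv.
Qed.

Lemma thirdP u v w : third u v = Some w <-> [set u; v; w] \in E.
Proof.
rewrite /third; case: pickP => [w' e|n]; last by rewrite n; split.
by split=> [[<-] //|e']; rewrite (edge_uniq e e').
Qed.

Lemma thirdC u v : third u v = third v u.
Proof. by apply: eq_pick => w; rewrite (setUC [set u]). Qed.

Lemma mmulC : commutative mmul.
Proof. by case=> [|u|u|] [|v|v|] //=; rewrite thirdC. Qed.

Lemma rot3 (u v w : V) : [set u; v; w] = [set v; w; u].
Proof. by apply/setP=> x; rewrite !inE; do 3 case: eqP. Qed.

Lemma mmulAAA u v w :
  mmul (mmul (MA u) (MA v)) (MA w) = if [set u; v; w] \in E then MT else MZ.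
Proof.
rewrite /=; case t: (third u v) => [w'|] /=.
  case: eqP => [->|n]; first by move/thirdP: t => ->.
  case: ifP => // e; case: n; move/thirdP: e; rewrite t; by case.
by case: ifP => // /thirdP; rewrite t.
Qed.

Lemma mmulA : associative mmul.
Proof.
have AAA u v w :
    mmul (MA u) (mmul (MA v) (MA w)) = mmul (mmul (MA u) (MA v)) (MA w).
  by rewrite mmulC !mmulAAA -rot3.
case=> [|u|u|] [|v|v|] [|w|w|] //=; try exact: AAA;
  by do ?case: third => [?|]; do ?case: eqP.
Qed.

Definition mgen (x : option V) : model := if x is Some u then MA u else MZ.

Fixpoint meval_seq (x : option V) (s : seq (option V)) : model :=
  if s is y :: s' then mmul (mgen x) (meval_seq y s') else mgen x.

Definition meval (w : word (option V)) : model := meval_seq w.1 w.2.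

Lemma mevalM u v : meval (u * v) = mmul (meval u) (meval v).
Proof.
case: u => x s; case: v => y t; rewrite /meval /=.
by elim: s x => //= x' s IH x; rewrite IH mmulA.
Qed.

Lemma subhyperedgeP u v :
  u != v -> subhyperedge [set u; v] -> exists w, [set u; v; w] \in E.
Proof.
move=> nuv [_ [e eE /subsetP s]].
have ue : u \in e by apply: s; rewrite !inE eqxx.
have ve : v \in e by apply: s; rewrite !inE eqxx orbT.
have sub : [set u; v] \subset e by apply/subsetP.
have c : #|e :\: [set u; v]| = 1%N.
  by rewrite cardsDS // (hyperedge_card eE) cards2 nuv.
have /cards1P[w ew] : #|e :\: [set u; v]| == 1%N by apply/eqP.
by exists w; rewrite -ew -{1}(setIidPr sub) setID.
Qed.


Lemma meval_cong u v : u ~= v -> meval u = meval v.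
Proof.
elim=> {u v} [u v r|//|//|u v w _ -> _ -> //|u u' v v' _ e1 _ e2]; last first.
  by rewrite !mevalM e1 e2.
case: r => {u v} [u v|//|//|//|u v n|u v h n|ui uj ur ul|u v w u' v' w' e e'].
- exact: mmulC.
- rewrite mevalM /=; case t: third => [w|//]; move/thirdP: t => t.
  have [nuv _ _] := edge_neq t; case: n => [uv|[]]; first by rewrite uv eqxx in nuv.
  split; last by exists [set u; v; w] => //; apply: subsetUl.
  by move/setP/(_ u); rewrite !inE eqxx.
- by rewrite !mevalM mmulAAA (negPf n).
- case=> _ _ [w [_ e1 e2]]; rewrite !mevalM /=.
  by rewrite setUC in e1; rewrite setUC in e2; rewrite (proj2 (thirdP _ _ _) e1) (proj2 (thirdP _ _ _) e2).
- by rewrite !mevalM !mmulAAA e e'.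
Qed.

Lemma pair_linked u v u' v' w :
  [set u; v; w] \in E -> [set u'; v'; w] \in E -> linked [set u; v] [set u'; v'].
Proof.
have sub x y z : [set x; y; z] \in E -> subhyperedge [set x; y].
  move=> e; split; last by exists [set x; y; z] => //; apply: subsetUl.
  by move/setP/(_ x); rewrite !inE eqxx.
move=> e e'; split; [exact: sub e|exact: sub e'|exists w].
have [_ nuw nvw] := edge_neq e; have [_ nuw' nvw'] := edge_neq e'.
rewrite ![w |: _]setUC e e' !inE ![w == _]eq_sym.
by rewrite (negPf nuw) (negPf nvw) (negPf nuw') (negPf nvw').
Qed.

Definition mform (m : model) (w : word (option V)) : Prop :=
  match m with
  | MZ => w ~= hzero
  | MA u => w ~= hgen u
  | MB x => exists u v, [set u; v; x] \in E /\ w ~= hgen u * hgen v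
  | MT => exists u v x, [set u; v; x] \in E /\ w ~= hgen u * hgen v * hgen x
  end.

Lemma hzeroM w : hzero * w ~= hzero /\ w * hzero ~= hzero.
Proof.
case: w => x s; elim: s x => [|y s IH] x.
  case: x => [u|]; split; apply: cong_rel; constructor.
have [IH1 IH2] := IH y.
have [h1 h2] : hzero * letter x ~= hzero /\ letter x * hzero ~= hzero.
  by case: x => [u|]; split; apply: cong_rel; constructor.
pose w : word (option V) := (x, y :: s); pose w' : word (option V) := (y, s).
have e1 : hzero * w ~= hzero * letter x * w' by apply: cong_refl.
have e2 : w * hzero ~= letter x * (w' * hzero) by apply: cong_refl.
split.
  apply: cong_trans e1 (cong_trans _ IH1).
  by apply: cong_mul h1 (cong_refl _ _).
apply: cong_trans e2 (cong_trans _ h2).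
by apply: cong_mul (cong_refl _ _) IH2.
Qed.

Lemma mformM u w m : mform m w -> mform (mmul (MA u) m) (hgen u * w).
Proof.
have step w' : w ~= w' -> hgen u * w ~= hgen u * w'.
  by apply: cong_mul; apply: cong_refl.
case: m => [|v|x|] /=.
- by move=> /step h; apply: cong_trans h _; apply: (proj2 (hzeroM _)).
- move=> /step h; case t: third => [x|] /=; first by exists u, v; split=> //; apply/thirdP.
  apply: cong_trans h _; apply/cong_rel/hrel_pair.
  have [uv|nuv] := eqVneq u v; [by left|right].
  by move=> /(subhyperedgeP nuv)[x /thirdP]; rewrite t.
- move=> [a [b [e /step h]]].
  have h' : hgen u * w ~= hgen u * hgen a * hgen b by exact: h.
  case: eqP => [ux|n].
    by exists u, a, b; split; [rewrite rot3 ux | exact: h'].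
  apply: cong_trans h' _; apply/cong_rel/hrel_triple/negP.
  by rewrite rot3 => e'; apply: n; apply: edge_uniq e' e.
- move=> [a [b [x [e /step h]]]]; apply: cong_trans h _.
  have [ua|nua] := boolP ([set u; a; b] \in E); last first.
    apply: (@cong_trans _ _ _ (hgen u * hgen a * hgen b * hgen x)).
      exact: cong_refl.
    apply: cong_trans _ (proj1 (hzeroM (hgen x))).
    by apply: cong_mul (cong_refl _ _); apply/cong_rel/hrel_triple.
  have ux : u = x by rewrite rot3 in ua; apply: edge_uniq ua e.
  rewrite -{x}ux in e *.
  apply: (@cong_trans _ _ _ (hgen u * (hgen u * (hgen a * hgen b)))).
    apply: cong_mul (cong_refl _ _) _; apply/cong_rel.
    by rewrite mulgA; apply: hrel_edge.
  rewrite mulgA; apply: cong_trans _ (proj1 (hzeroM (hgen a * hgen b))).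
  by apply: cong_mul (cong_refl _ _); apply/cong_rel/hrel_pair; left.
Qed.

Lemma mform_meval w : mform (meval w) w.
Proof.
case: w => x s; elim: s x => [|y s IH] x.
  by case: x => [u|]; apply: cong_refl.
case: x => [u|]; last exact: (proj1 (hzeroM (y, s))).
exact: mformM (IH y).
Qed.

Lemma mevalP u v : u ~= v <-> meval u = meval v.
Proof.
split=> [|e]; first exact: meval_cong.
have := mform_meval u; have := mform_meval v; rewrite -e.
case: (meval u) => [|a|x|] /=.
- by move=> h1 h2; apply: cong_trans h2 (cong_sym h1).
- by move=> h1 h2; apply: cong_trans h2 (cong_sym h1).
- move=> [a [b [e1 h1]]] [c [d [e2 h2]]].
  apply: cong_trans h2 (cong_trans _ (cong_sym h1)).
  exact/cong_rel/hrel_linked/(pair_linked e2 e1).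
- move=> [a [b [x [e1 h1]]]] [c [d [y [e2 h2]]]].
  apply: cong_trans h2 (cong_trans _ (cong_sym h1)).
  exact/cong_rel/hrel_edge.
Qed.

Lemma mmul_cancel x y t : mmul x y = mmul x t -> mmul x y <> MZ -> y = t.
Proof.
case: x y t => [|u|u|] [|v|v|] [|w|w|] //=.
- case t1: third => [a|] //; case t2: third => [b|] // [ab] _.
  move/thirdP: t1 => t1; move/thirdP: t2; rewrite -{b}ab => t2.
  rewrite setUAC in t1; rewrite setUAC in t2.
  by rewrite (edge_uniq t1 t2).
- by case: third => [a|]; case: eqP.
- by case: third => [a|]; case: eqP.
- by case: eqP => [->|//]; case: eqP => [->|].
- by case: eqP => [->|//]; case: eqP => [->|].
Qed.

Lemma hypergraph_zeroP : absorbing hypergraph_zero.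
Proof.
elim/(@quotW _ (presented hrel)) => w; rewrite /hypergraph_zero -!piM.
by split; apply/presented_eqP; have [] := hzeroM w.
Qed.

Lemma hypergraph_mulC : commutative (@mul hypergraph_semigroup).
Proof.
elim/(@quotW _ (presented hrel)) => u; elim/(@quotW _ (presented hrel)) => v.
by rewrite -!piM; apply/presented_eqP/mevalP; rewrite !mevalM mmulC.
Qed.

Lemma hypergraph_zero_cancellative : zero_cancellative hypergraph_zero.
Proof.
have cancel (x y t : hypergraph_semigroup) :
    x * y = x * t -> x * y <> hypergraph_zero -> y = t.
  elim/(@quotW _ (presented hrel)): x => x.
  elim/(@quotW _ (presented hrel)): y => y.
  elim/(@quotW _ (presented hrel)): t => t.
  rewrite /hypergraph_zero -!piM => /presented_eqP/mevalP; rewrite !mevalM => e n.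
  apply/presented_eqP/mevalP; apply: mmul_cancel e _ => z; apply: n.
  by apply/presented_eqP/mevalP; rewrite mevalM z.
by split=> // x y t; rewrite ![_ * x]hypergraph_mulC; apply: cancel.
Qed.

Lemma hyperedge_product_neq0 u v w : [set u; v; w] \in E ->
  (\pi_(presented hrel) (hgen u * hgen v * hgen w))%qT <> hypergraph_zero.
Proof. by move=> e /presented_eqP/mevalP; rewrite !mevalM mmulAAA e. Qed.

End HypergraphSemigroup.

Definition hypergraph_semiring (H : hypergraph) : semiring :=
  flat_semiring (@hypergraph_zeroP H) (@hypergraph_zero_cancellative H).

(** * Fans and the triangle *)

Section Fan.
Variable i : nat.

Definition fan_vertex : finType := option ('I_i.+1 + 'I_i.+1 + 'I_i).

Definition apex : fan_vertex := None.
Definition rim (j : 'I_i.+1) : fan_vertex := Some (inl (inl j)).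
Definition spoke_mid (j : 'I_i.+1) : fan_vertex := Some (inl (inr j)).
(* [rim_mid k] is t_{k+1}, between r_k and r_{k+1}. *)
Definition rim_mid (k : 'I_i) : fan_vertex := Some (inr k).

Definition fan_spoke (j : 'I_i.+1) : {set fan_vertex} :=
  [set apex; spoke_mid j; rim j].

Definition fan_side (k : 'I_i) : {set fan_vertex} :=
  [set rim (widen_ord (leqnSn i) k); rim_mid k; rim (lift ord0 k)].

Definition fan_edges : {set {set fan_vertex}} :=
  [set fan_spoke j | j in 'I_i.+1] :|: [set fan_side k | k in 'I_i].

Lemma cards3 (T : finType) (x y z : T) :
  x != y -> x != z -> y != z -> #|[set x; y; z]| = 3.
Proof.
by move=> xy xz yz; rewrite setUC cardsU1 cards2 !inE xy ![z == _]eq_sym (negPf xz) (negPf yz).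
Qed.

Lemma rim_neq (k : 'I_i) : widen_ord (leqnSn i) k != lift ord0 k.
Proof. by rewrite -val_eqE /= /bump /= add1n neq_ltn leqnn. Qed.

Lemma fan_edgesP e : e \in fan_edges ->
  (exists j, e = fan_spoke j) \/ (exists k, e = fan_side k).
Proof.
by rewrite inE => /orP[] /imsetP[j _ ->]; [left|right]; exists j.
Qed.

Lemma fan_card e : e \in fan_edges -> #|e| = 3.
Proof.
move=> /fan_edgesP[] [j ->]; apply: cards3 => //.
by apply: contra_neq (rim_neq j) => -[] ek; apply: val_inj.
Qed.

Lemma fan_spokeE j x : (x \in fan_spoke j) =
  match x with
  | None => true
  | Some (inl (inl a)) | Some (inl (inr a)) => a == j
  | Some (inr _) => false
  end.
Proof. by case: x => [[[a|a]|a]|]; rewrite !inE /= ?orbF. Qed.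

Lemma fan_sideE k x : (x \in fan_side k) =
  match x with
  | Some (inl (inl a)) => (a == k :> nat) || (a == k.+1 :> nat)
  | Some (inr a) => a == k
  | _ => false
  end.
Proof.
case: x => [[[a|a]|a]|]; rewrite !inE //; last exact: orbF.
by rewrite [X in X || _]orbF.
Qed.

Lemma fan_linear e f : e \in fan_edges -> f \in fan_edges ->
  e != f -> #|e :&: f| <= 1.
Proof.
have mixed j k : #|fan_spoke j :&: fan_side k| <= 1.
  apply/card_le1_eqP => x y; rewrite !in_setI !fan_spokeE !fan_sideE.
  by case: x => [[[a|a]|a]|]; case: y => [[[b|b]|b]|] //=; rewrite ?andbF //;
    move=> /andP[/eqP -> _] /andP[/eqP -> _].
move=> /fan_edgesP[] [j ->] /fan_edgesP[] [k ->] njk //; last first.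
- apply/card_le1_eqP => x y; rewrite !in_setI !fan_sideE.
  have {}njk : (j != k :> nat) by apply: contra njk => /eqP/val_inj ->.
  case: x => [[[a|a]|a]|] //; case: y => [[[b|b]|b]|] //.
  + move=> /andP[ha ha'] /andP[hb hb']; congr (Some (inl (inl _))).
    apply: val_inj => /=; move: (nat_of_ord a) (nat_of_ord b) ha ha' hb hb'.
    by move=> {}a {}b; lia.
  + by move=> _ /andP[/eqP -> /eqP jk]; rewrite jk eqxx in njk.
  + by move=> /andP[/eqP -> /eqP jk]; rewrite jk eqxx in njk.
  + by move=> /andP[/eqP -> /eqP jk]; rewrite jk eqxx in njk.
- by rewrite setIC.
- apply/card_le1_eqP => x y; rewrite !in_setI !fan_spokeE.
  have {}njk : j != k by apply: contra njk => /eqP ->.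
  case: x => [[[a|a]|a]|] //; case: y => [[[b|b]|b]|] //.
  all: try by move=> /andP[/eqP -> /eqP jk]; rewrite jk eqxx in njk.
  all: by move=> _ /andP[/eqP -> /eqP jk]; rewrite jk eqxx in njk.
Qed.

Lemma fan_covered x : exists2 e, e \in fan_edges & x \in e.
Proof.
case: x => [[[j|j]|k]|].
- by exists (fan_spoke j); rewrite ?fan_spokeE // inE imset_f.
- by exists (fan_spoke j); rewrite ?fan_spokeE // inE imset_f.
- by exists (fan_side k); rewrite ?fan_sideE // inE orbC imset_f.
- by exists (fan_spoke ord0); rewrite ?fan_spokeE // inE imset_f.
Qed.

Definition fan : hypergraph := Hypergraph fan_card fan_linear fan_covered.

End Fan.

(* u_1, ..., u_6 are the elements 0, ..., 5 of 'I_6. *)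
Definition triangle_vertex (k : nat) : 'I_6 := inord k.-1.

Definition triangle_edge (a b c : nat) : {set 'I_6} :=
  [set triangle_vertex a; triangle_vertex b; triangle_vertex c].

Definition triangle_edges : {set {set 'I_6}} :=
  [set triangle_edge 1 2 3; triangle_edge 3 4 5; triangle_edge 5 6 1].

Lemma triangle_edgeE a b c (x : 'I_6) : a.-1 < 6 -> b.-1 < 6 -> c.-1 < 6 ->
  (x \in triangle_edge a b c) = (val x \in [:: a.-1; b.-1; c.-1]).
Proof. by move=> a6 b6 c6; rewrite !inE -!val_eqE /= !inordK // orbA. Qed.

Lemma triangle_card e : e \in triangle_edges -> #|e| = 3.
Proof.
by rewrite !inE => /orP[/orP[]|] /eqP->; apply: cards3; rewrite -val_eqE /= !inordK.
Qed.

Lemma triangle_linear e f : e \in triangle_edges -> f \in triangle_edges ->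
  e != f -> #|e :&: f| <= 1.
Proof.
rewrite !inE => /orP[/orP[]|] /eqP-> /orP[/orP[]|] /eqP->; rewrite ?eqxx // => _;
  apply/card_le1_eqP => x y; rewrite !in_setI !triangle_edgeE // !inE /=;
  move=> hx hy; apply: val_inj => /=; lia.
Qed.

Lemma triangle_covered x : exists2 e, e \in triangle_edges & x \in e.
Proof.
have [l1|g1] := leqP x 2.
  exists (triangle_edge 1 2 3); first by rewrite !inE eqxx.
  by rewrite triangle_edgeE // !inE /=; lia.
have [l2|g2] := leqP x 4.
  exists (triangle_edge 3 4 5); first by rewrite !inE eqxx orbT.
  by rewrite triangle_edgeE // !inE /=; lia.
exists (triangle_edge 5 6 1); first by rewrite !inE eqxx orbT.
by rewrite triangle_edgeE // !inE /=; have := ltn_ord x; lia.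
Qed.

Definition triangle : hypergraph :=
  Hypergraph triangle_card triangle_linear triangle_covered.

(* Main.v *)
(* If homomorphisms of hypergraphs H -> K jointly reflect hyperedges, then S_H
   lies in the variety of S_K: in a power of S_K, the tuples of images of the
   generators a_u generate a subalgebra that maps onto S_H by collapsing to 0
   every element dividing no hyperedge product. The triangle embeds in each fan
   as two consecutive spokes with the side between them. Conversely, each side
   of a fan yields a homomorphism to the triangle that folds the rest of the fan
   onto the two spokes around this side, and these foldings jointly reflect
   hyperedges. *)
Require Import Defs.
From mathcomp Require Import all_boot.
From HB Require Import structures.
From mathcomp Require Import generic_quotient boolp zify.

Set Implicit Arguments.
Unset Strict Implicit.
Unset Printing Implicit Defensive.

(** * Closure of generated varieties under powers, subalgebras and quotients *)

Lemma variety_trans (S T U : semiring) : variety S T -> variety T U -> variety S U.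
Proof. by move=> ST TU K varK KS; apply: TU => //; apply: ST. Qed.

Lemma variety_surj (S T : semiring) (f : S -> T) :
  semiring_hom f -> (forall y, exists x, f x = y) -> variety S T.
Proof. by move=> homf surjf K [clH _ _]; exact: clH homf surjf. Qed.

Lemma variety_inj (S T : semiring) (f : S -> T) :
  semiring_hom f -> injective f -> variety T S.
Proof. by move=> homf injf K [_ clS _]; exact: clS homf injf. Qed.

Lemma variety_power (I : Type) (S : semiring) :
  variety S (product_semiring (fun _ : I => S)).
Proof. by move=> K [_ _ clP] KS; apply: clP. Qed.

Section Subsemiring.
Variables (S : semiring) (P : S -> Prop).
Hypotheses (P_inh : exists x, P x)
  (PD : forall x y, P x -> P y -> P (sadd x y))
  (PM : forall x y, P x -> P y -> P (smul x y)).

Let sub := {x : S | P x}.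
Let add (x y : sub) : sub := exist P _ (PD (proj2_sig x) (proj2_sig y)).
Let mul (x y : sub) : sub := exist P _ (PM (proj2_sig x) (proj2_sig y)).

Lemma sub_sval_inj : injective (@proj1_sig S P).
Proof. by move=> [x Px] [y Py] /= xy; exact: eq_exist. Qed.

Lemma sub_inhabited : inhabited sub.
Proof. by have [x Px] := P_inh; exists; exists x. Qed.

Lemma sub_addA : associative add.
Proof. by move=> x y z; apply: sub_sval_inj; exact: saddA. Qed.

Lemma sub_addC : commutative add.
Proof. by move=> x y; apply: sub_sval_inj; exact: saddC. Qed.

Lemma sub_mulA : associative mul.
Proof. by move=> x y z; apply: sub_sval_inj; exact: smulA. Qed.

Lemma sub_mulDl : left_distributive mul add.
Proof. by move=> x y z; apply: sub_sval_inj; exact: smulDl. Qed.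

Lemma sub_mulDr : right_distributive mul add.
Proof. by move=> x y z; apply: sub_sval_inj; exact: smulDr. Qed.

Definition subsemiring : semiring :=
  Semiring sub_inhabited sub_addA sub_addC sub_mulA sub_mulDl sub_mulDr.

Lemma variety_subsemiring : variety S subsemiring.
Proof.
exact: (@variety_inj subsemiring S (@proj1_sig S P)) sub_sval_inj.
Qed.

End Subsemiring.

(** Since [f] respects the operations only on [P], it is first restricted to the subalgebra carried
    by [P], where it is a surjective homomorphism. *)
Lemma variety_subquotient (S T : semiring) (P : S -> Prop) (f : S -> T) :
  (forall x y, P x -> P y ->
    P (sadd x y) /\ f (sadd x y) = sadd (f x) (f y)) ->
  (forall x y, P x -> P y ->
    P (smul x y) /\ f (smul x y) = smul (f x) (f y)) ->
  (forall t, exists2 x, P x & f x = t) -> variety S T.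
Proof.
move=> fD fM fsurj.
have P_inh : exists x, P x.
  by have [t] := s_inhabited T; have [x Px _] := fsurj t; exists x.
have PD x y Px Py := proj1 (fD x y Px Py).
have PM x y Px Py := proj1 (fM x y Px Py).
apply: variety_trans (variety_subsemiring P_inh PD PM) _.
apply: (@variety_surj _ _ (fun x : subsemiring P_inh PD PM => f (proj1_sig x))).
  split=> -[x Px] [y Py] /=; first by case: (fD x y Px Py).
  by case: (fM x y Px Py).
by move=> t; have [x Px fxt] := fsurj t; exists (exist _ x Px).
Qed.

(** Injectivity keeps distinct summands distinct, so a sum that collapses to zero still does so
    after [f]. *)
Lemma flat_hom (S T : semigroupType) (zS : S) (zT : T)
    (aS : absorbing zS) (cS : zero_cancellative zS)
    (aT : absorbing zT) (cT : zero_cancellative zT) (f : S -> T) :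
  injective f -> f zS = zT -> {morph f : x y / (x * y)%g} ->
  @semiring_hom (flat_semiring aS cS) (flat_semiring aT cT) f.
Proof.
move=> injf f0 fM; split=> // x y; rewrite /= /flat_add (inj_eq injf).
by case: ifP.
Qed.

(** * The model of the hypergraph semigroup as a flat semiring *)

HB.instance Definition _ (H : hypergraph) := gen_eqMixin (model H).
HB.instance Definition _ (H : hypergraph) := gen_choiceMixin (model H).
HB.instance Definition _ (H : hypergraph) :=
  isSemigroup.Build (model H) (@mmulA H).

Section Model.
Variable H : hypergraph.
Local Notation V := (vertex H).
Local Notation E := (hyperedges H).
Local Open Scope quotient_scope.

Lemma mmulz (x : model H) : mmul x (MZ H) = MZ H.
Proof. by case: x. Qed.

Lemma mmul_neqZ (x y : model H) :
  mmul x y <> MZ H -> x <> MZ H /\ y <> MZ H.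
Proof. by move=> nz; split=> e; apply: nz; rewrite e ?mmulz. Qed.

Lemma model_absorbing : @absorbing (model H) (MZ H).
Proof. by move=> x; split; [|exact: mmulz]. Qed.

Lemma model_cancellative : @zero_cancellative (model H) (MZ H).
Proof.
split=> x y t; first exact: mmul_cancel.
change (mmul y x = mmul t x -> mmul y x <> MZ H -> y = t); rewrite ![mmul _ x]mmulC; exact: mmul_cancel.
Qed.

Definition model_semiring : semiring :=
  flat_semiring model_absorbing model_cancellative.

Definition to_model (x : hypergraph_semigroup H) : model H := meval (repr x).

Lemma to_modelE w : to_model (\pi_(presented (@hrel H)) w) = meval w.
Proof. by apply/mevalP/presented_eqP; rewrite reprK. Qed.

Lemma to_model_inj : injective to_model.
Proof.
elim/(@quotW _ (presented (@hrel H))) => u.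
elim/(@quotW _ (presented (@hrel H))) => v.
by rewrite !to_modelE => /mevalP/presented_eqP.
Qed.

Lemma to_model_hom :
  @semiring_hom (hypergraph_semiring H) model_semiring to_model.
Proof.
apply: flat_hom; [exact: to_model_inj | exact: to_modelE |].
elim/(@quotW _ (presented (@hrel H))) => u.
elim/(@quotW _ (presented (@hrel H))) => v.
by rewrite -piM !to_modelE mevalM.
Qed.

Lemma vertex_edge (w : V) : exists u v, [set u; v; w] \in E.
Proof.
have [e eE we] := vertex_covered w.
have /cards2P[u [v [_ euv]]] : #|e :\ w| == 2.
  by have := cardsD1 w e; rewrite we (hyperedge_card eE) add1n => -[<-].
by exists u, v; rewrite -euv setUC; have -> : w |: (e :\ w) = e by exact: setD1K.
Qed.

(** The vertex [v0] guarantees a hyperedge; without one, [MT] would be the value of no word. *)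
Lemma to_model_surj (v0 : V) y : exists x, to_model x = y.
Proof.
case: y => [|u|w|].
- by exists (hypergraph_zero H); exact: to_modelE.
- by exists (\pi_(presented (@hrel H)) (hgen u)); exact: to_modelE.
- have [u [v /thirdP e]] := vertex_edge w.
  by exists (\pi_(presented (@hrel H)) (hgen u * hgen v)%g); rewrite to_modelE mevalM /= e.
- have [u [v e]] := vertex_edge v0.
  exists (\pi_(presented (@hrel H)) (hgen u * hgen v * hgen v0)%g).
  by rewrite to_modelE !mevalM mmulAAA e.
Qed.

Lemma variety_model : variety model_semiring (hypergraph_semiring H).
Proof. exact: variety_inj to_model_hom to_model_inj. Qed.

Lemma variety_hypergraph (v0 : V) :
  variety (hypergraph_semiring H) model_semiring.
Proof. exact: variety_surj to_model_hom (to_model_surj v0). Qed.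

End Model.

(** * Hypergraph homomorphisms and reflecting families *)

Definition hypergraph_hom (H K : hypergraph) (phi : vertex H -> vertex K) :=
  forall e, e \in hyperedges H -> phi @: e \in hyperedges K.

Lemma imset3 (aT rT : finType) (f : aT -> rT) x y z :
  f @: [set x; y; z] = [set f x; f y; f z].
Proof. by rewrite !imsetU !imset_set1. Qed.

Lemma hypergraph_hom3 (H K : hypergraph) (phi : vertex H -> vertex K) u v w :
  hypergraph_hom phi -> [set u; v; w] \in hyperedges H ->
  [set phi u; phi v; phi w] \in hyperedges K.
Proof. by move=> hom e; rewrite -imset3; apply: hom. Qed.

Section ReflectingFamily.
Variables (H K : hypergraph) (I : Type) (i0 : I).
Variable phi : I -> vertex H -> vertex K.
Hypothesis phi_hom : forall i, hypergraph_hom (phi i).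
Hypothesis phi_reflect : forall u v w,
  (forall i, [set phi i u; phi i v; phi i w] \in hyperedges K) ->
  [set u; v; w] \in hyperedges H.

(** Complete [v] to a hyperedge with [a] and [b]. Every [phi i] also sends [a], [b], [u] to a
    hyperedge, so reflection makes them one in [H], and two vertices determine the third. *)
Lemma phi_separates u v : (forall i, phi i u = phi i v) -> u = v.
Proof.
move=> uv; have [a [b e]] := vertex_edge v.
apply: (edge_uniq _ e); apply: phi_reflect => i.
by rewrite uv; apply: hypergraph_hom3 e.
Qed.

Let mpow := product_semiring (fun _ : I => model_semiring K).

(** Not a homomorphism in general: where a product is [MZ] in the model of [H], the product of the
    images may be nonzero in some coordinates. The map used in the end is [psi_inv], whose default
    value [MZ] absorbs this defect. *)
Definition psi (y : model H) : mpow := fun i =>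
  match y with
  | MZ => MZ K
  | MA u => MA (phi i u)
  | MB w => MB (phi i w)
  | MT => MT K
  end.

Lemma psi_inj : injective psi.
Proof.
move=> y y' e; have ei i : psi y i = psi y' i by rewrite e.
case: y y' ei {e} => [|u|u|] [|v|v|] ei //; try by have := ei i0.
- by rewrite (@phi_separates u v) // => i; case: (ei i).
- by rewrite (@phi_separates u v) // => i; case: (ei i).
Qed.

Definition psi_inv (x : mpow) : model H :=
  if pselect (exists y, psi y = x) is left e then projT1 (cid e) else MZ H.

Lemma psiK : cancel psi psi_inv.
Proof.
move=> y; rewrite /psi_inv; case: pselect => [e|[]]; last by exists y.
by apply: psi_inj; case: cid.
Qed.

Lemma psi_invK x : psi_inv x <> MZ H -> psi (psi_inv x) = x.
Proof. by rewrite /psi_inv; case: pselect => // e; case: cid. Qed.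

Lemma psi_neqZ y i : y <> MZ H -> psi y i <> MZ K.
Proof. by case: y. Qed.

Lemma psiM y y' : mmul y y' <> MZ H -> psi (mmul y y') = smul (psi y) (psi y').
Proof.
move=> nz; apply: functional_extensionality_dep => i; move: nz.
case: y y' => [|u|u|] [|v|v|] //=.
- case t: third => [w|//] _ /=.
  by move/thirdP: t => /(hypergraph_hom3 (phi_hom i))/thirdP; rewrite /mul /= => ->.
- by case: eqP => // -> _; rewrite /mul /= eqxx.
- by case: eqP => // -> _; rewrite /mul /= eqxx.
Qed.

(* The subalgebra generated by the [psi (MA u)] consists of such elements;
   those outside the image of [psi] form the ideal collapsed to 0. *)
Definition homogeneous (x : mpow) : Prop :=
  [\/ exists i, x i = MZ K, exists u, x = psi (MA u),
      forall i, exists w, x i = MB w | x = psi (MT H)].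

Lemma homogeneous_psi y : homogeneous (psi y).
Proof.
case: y => [|u|w|].
- by apply: Or41; exists i0.
- by apply: Or42; exists u.
- by apply: Or43 => i; exists (phi i w).
- exact: Or44.
Qed.

Lemma mpow_mulC (x y : mpow) : smul x y = smul y x.
Proof. by apply: functional_extensionality_dep => i; exact: mmulC. Qed.

Lemma mpow_addP (x y : mpow) : x = y \/ exists i, sadd x y i = MZ K.
Proof.
have [xy|nxy] := pselect (forall i, x i = y i).
  by left; apply: functional_extensionality_dep.
right; apply: contrapT => nz; apply: nxy => i; apply: contrapT => /eqP nxyi.
by apply: nz; exists i; rewrite /= /flat_add (negPf nxyi).
Qed.

Lemma homogeneousD x y :
  homogeneous x -> homogeneous y -> homogeneous (sadd x y).
Proof.
move=> hx hy; have [<-|z] := mpow_addP x y; last exact: Or41.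
suff -> : sadd x x = x by [].
by apply: functional_extensionality_dep => i; rewrite /= /flat_add eqxx.
Qed.

(** When no coordinate of the product vanishes, each factor has one kind across all coordinates, and
    only two combinations survive: [MA] by [MA] gives [MB] everywhere, and [MA] by [MB] gives [MT]
    everywhere. *)
Lemma homogeneousM x y :
  homogeneous x -> homogeneous y -> homogeneous (smul x y).
Proof.
move=> hx hy.
have [z|nz] := pselect (exists i, smul x y i = MZ K); first exact: Or41.
have {}nz i : mmul (x i) (y i) <> MZ K by move=> z; apply: nz; exists i.
have AB (x' y' : mpow) (u : vertex H) : (forall i, mmul (x' i) (y' i) <> MZ K) ->
    x' = psi (MA u) -> (forall i, exists w, y' i = MB w) -> smul x' y' = psi (MT H).
  move=> {}nz ex hy'; apply: functional_extensionality_dep => i.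
  have := nz i; have [w] := hy' i; rewrite {1}ex /= /mul /= ex => ->.
  by rewrite /=; case: eqP.
case: hx hy => [[i xz]|[u xu]|xB|xT].
- by have [] := mmul_neqZ (nz i).
- case=> [[i yz]|[v yv]|yB|yT].
  + by have [] := mmul_neqZ (nz i).
  + apply: Or43 => i; have := nz i; rewrite xu yv /= /mul /=.
    by case: third => // w _; exists w.
  + by apply: Or44; exact: AB xu yB.
  + by have := nz i0; rewrite xu yT.
- case=> [[i yz]|[v yv]|yB|yT].
  + by have [] := mmul_neqZ (nz i).
  + apply: Or44; rewrite mpow_mulC; apply: AB yv xB => i; rewrite mmulC; exact: nz.
  + by have := nz i0; have [a ->] := xB i0; have [b ->] := yB i0.
  + by have := nz i0; rewrite yT; have [a ->] := xB i0.
- by have := nz i0; rewrite xT; case: (y i0).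
Qed.

(** This makes what [psi_inv] collapses an ideal. For two generators, each coordinate of the product
    yields a hyperedge of [K], and reflection lifts these to one hyperedge of [H]. For a generator
    by an [MB] tuple, nonvanishing forces the indices of the tuple to be the images of that
    generator. *)
Lemma psi_factor x y z : homogeneous x -> homogeneous y -> z <> MZ H ->
  smul x y = psi z -> exists x' y', [/\ x = psi x', y = psi y' & mmul x' y' = z].
Proof.
move=> hx hy zn e.
have ei i : mmul (x i) (y i) = psi z i by rewrite -e.
have nz i : mmul (x i) (y i) <> MZ K by rewrite ei; exact: psi_neqZ.
have AB (x1 y1 : mpow) (u : vertex H) : (forall i, mmul (x1 i) (y1 i) = psi z i) ->
    x1 = psi (MA u) -> (forall i, exists w, y1 i = MB w) ->
    y1 = psi (MB u) /\ z = MT H.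
  move=> {}ei ex yB.
  have ui i : y1 i = MB (phi i u) /\ z = MT H.
    have := ei i; have [w ->] := yB i; rewrite ex /=.
    by case: eqP => [->|_]; case: z zn {e ei nz} => // v _; rewrite /psi.
  split; last by case: (ui i0).
  by apply: functional_extensionality_dep => i; case: (ui i).
case: hx hy => [[i xz]|[u xu]|xB|xT].
- by have [] := mmul_neqZ (nz i).
- case=> [[i yz]|[v yv]|yB|yT].
  + by have [] := mmul_neqZ (nz i).
  + exists (MA u), (MA v); split=> //.
    have {}ei i : exists2 w, [set phi i u; phi i v; w] \in hyperedges K & psi z i = MB w.
      have := ei i; have := nz i; rewrite xu yv /=.
      by case t: third => [w|//] _ <-; exists w => //; apply/thirdP.
    case: z zn e ei {nz AB} => [|w|w|] // _ e ei; try by have [] := ei i0.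
    rewrite /=; suff /thirdP -> : [set u; v; w] \in hyperedges H by [].
    by apply: phi_reflect => i; have [w' + [->]] := ei i.
  + have [yu ->] := AB _ _ _ ei xu yB; exists (MA u), (MB u).
    by split=> //=; rewrite eqxx.
  + by have := nz i0; rewrite xu yT.
- case=> [[i yz]|[v yv]|yB|yT].
  + by have [] := mmul_neqZ (nz i).
  + have [|xv ->] := AB _ _ _ _ yv xB; first by move=> i; rewrite mmulC.
    by exists (MB v), (MA v); split=> //=; rewrite eqxx.
  + by have := nz i0; have [a ->] := xB i0; have [b ->] := yB i0.
  + by have := nz i0; rewrite yT; have [a ->] := xB i0.
- by have := nz i0; rewrite xT; case: (y i0).
Qed.

Lemma psi_invM x y : homogeneous x -> homogeneous y ->
  psi_inv (smul x y) = mmul (psi_inv x) (psi_inv y).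
Proof.
move=> hx hy; have [z|nz] := pselect (psi_inv (smul x y) = MZ H).
  (* If the right side were nonzero, both factors would be images under [psi], and [psiM] would make
     [smul x y] the image of that nonzero product. *)
  rewrite z; apply: contrapT => /nesym nz; have [nx ny] := mmul_neqZ nz.
  by apply: (nz); rewrite -z -[mmul _ _]psiK psiM // !psi_invK.
have := psi_invK nz; move=> /esym/(psi_factor hx hy nz)[x' [y' [-> ->]]].
by rewrite !psiK.
Qed.

Lemma psi_invD x y :
  psi_inv (sadd x y) = flat_add (MZ H) (psi_inv x) (psi_inv y).
Proof.
rewrite /flat_add; have [<-|[i z]] := mpow_addP x y.
  rewrite eqxx; congr psi_inv.
  by apply: functional_extensionality_dep => i; rewrite /= /flat_add eqxx.
have zxy : psi_inv (sadd x y) = MZ H.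
  apply: contrapT => nz; have := @psi_neqZ _ i nz.
  by rewrite (psi_invK nz).
(* Equal nonzero inverse images would force [x = y]; the zero coordinate of the sum would then be
   one of [x], impossible for a nonzero image. *)
rewrite zxy; case: eqP => // e; apply: contrapT => /nesym nx.
have ny : psi_inv y <> MZ H by rewrite -e.
have xy : x = y by rewrite -(psi_invK nx) -(psi_invK ny) e.
have := @psi_neqZ _ i nx; apply; rewrite psi_invK // -z xy /=.
by rewrite /flat_add eqxx.
Qed.

Lemma variety_reflecting_family : variety (model_semiring K) (model_semiring H).
Proof.
apply: variety_trans (@variety_power I _) _.
apply: (@variety_subquotient mpow (model_semiring H) homogeneous psi_inv).
- by move=> x y hx hy; split; [exact: homogeneousD|exact: psi_invD].
- by move=> x y hx hy; split; [exact: homogeneousM|exact: psi_invM].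
- by move=> y; exists (psi y); [exact: homogeneous_psi|exact: psiK].
Qed.

End ReflectingFamily.

(** * Hyperedges of the triangle in numerical labels *)

Lemma hyperedge3P (H : hypergraph) (u v w : vertex H) :
  reflect ([/\ u != v, u != w, v != w &
            exists2 e, e \in hyperedges H & [&& u \in e, v \in e & w \in e]])
          ([set u; v; w] \in hyperedges H).
Proof.
apply: (iffP idP) => [eE|[uv uw vw [e eE /and3P[ue ve we]]]].
  have [uv uw vw] := edge_neq eE; split=> //.
  by exists [set u; v; w]; rewrite ?inE ?eqxx ?orbT.
suff -> : [set u; v; w] = e by [].
apply/eqP; rewrite eqEcard (hyperedge_card eE) cards3 // leqnn andbT.
by rewrite !subUset !sub1set ue ve we.
Qed.

(** Labels are zero-based: [tri n] is $u_{n+1}$, with corners at 0, 2, 4 and midpoints at 1, 3,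
    5. *)
Definition tri (n : nat) : vertex triangle := inord n.

Definition tri_edge (x y z : nat) : bool :=
  [&& x != y, x != z, y != z &
   [|| all (mem [:: 0; 1; 2]) [:: x; y; z], all (mem [:: 2; 3; 4]) [:: x; y; z]
     | all (mem [:: 4; 5; 0]) [:: x; y; z]]].

Lemma tri_edgeP x y z : x < 6 -> y < 6 -> z < 6 ->
  ([set tri x; tri y; tri z] \in hyperedges triangle) = tri_edge x y z.
Proof.
move=> x6 y6 z6.
have tri_neq m n : m < 6 -> n < 6 -> (tri m != tri n) = (m != n).
  by move=> m6 n6; rewrite -val_eqE /= !inordK.
apply/hyperedge3P/and4P; rewrite !tri_neq // => -[xy xz yz e]; split=> //.
  case: e => e; rewrite [hyperedges _]/= !in_setU !in_set1 => /orP[/orP[]|] /eqP ->;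
  by rewrite !triangle_edgeE //= !inordK // !andbT => ->; rewrite ?orbT.
have tri_in a b c n : a.-1 < 6 -> b.-1 < 6 -> c.-1 < 6 -> n < 6 ->
    (tri n \in triangle_edge a b c) = (n \in [:: a.-1; b.-1; c.-1]).
  by move=> a6 b6 c6 n6; rewrite triangle_edgeE //= inordK.
case/or3P: e => /and4P[ex ey ez _];
  [exists (triangle_edge 1 2 3) | exists (triangle_edge 3 4 5)
  | exists (triangle_edge 5 6 1)]; rewrite ?tri_in //; try exact/and3P;
  by rewrite [hyperedges _]/= !in_setU !in_set1 eqxx ?orbT.
Qed.

(** * Foldings of a fan onto the triangle *)

Section FanCut.
Variable i : nat.

(* The apex goes to u_1 and the spokes j <= m are folded onto {u_1, u_2, u_3},
   the others onto {u_5, u_6, u_1}; the side between the spokes m and m + 1 is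
   the only one sent to {u_3, u_4, u_5}. *)
Definition cut_val (m : nat) (x : vertex (fan i)) : nat :=
  match x with
  | None => 0
  | Some (inl (inl j)) =>
      if j <= m then (if odd (m - j) then 1 else 2)
      else (if odd (j - m.+1) then 5 else 4)
  | Some (inl (inr j)) =>
      if j <= m then (if odd (m - j) then 2 else 1)
      else (if odd (j - m.+1) then 4 else 5)
  | Some (inr k) => if k == m :> nat then 3 else 0
  end.

Lemma cut_val_lt m x : cut_val m x < 6.
Proof. by case: x => [[[j|j]|k]|] //=; do ?case: ifP. Qed.

Definition cut (m : 'I_i) (x : vertex (fan i)) : vertex triangle :=
  tri (cut_val m x).

(** The parity alternation gives the two rim corners of an uncut side different labels, 1 and 2 or 4
    and 5, and its midpoint joins the apex at 0. The cut side receives 2, 3, 4. *)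
Lemma cut_hom m : hypergraph_hom (cut m).
Proof.
move=> e /fan_edgesP[] [j ->]; rewrite imset3 tri_edgeP ?cut_val_lt //= /tri_edge /= !inE.
  by case: (j <= m); case: odd.
rewrite /bump /= add1n; case: (ltngtP j m) => jm.
- by rewrite -(subnSK jm) /=; case: odd.
- by rewrite (subSn jm) /=; case: odd.
- by rewrite jm !subnn.
Qed.

(** These are the apex and the rim midpoints. Every cut sends exactly these to 0 or 3, and each
    hyperedge of the triangle contains exactly one of these two labels. *)
Definition axial (x : vertex (fan i)) : bool :=
  if x is Some (inl _) then false else true.

Definition spoke_index (x : vertex (fan i)) : nat :=
  match x with
  | Some (inl (inl j)) | Some (inl (inr j)) => j
  | _ => 0
  end.

Lemma axial_val m x : axial x = (cut_val m x \in [:: 0; 3]).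
Proof. by case: x => [[[j|j]|k]|] //=; do ?case: ifP. Qed.

Lemma near_val m x : ~~ axial x -> spoke_index x <= m ->
  cut_val m x \in [:: 1; 2].
Proof. by case: x => [[[j|j]|k]|] //= _ ->; case: ifP. Qed.

Lemma far_val m x : ~~ axial x -> m < spoke_index x ->
  cut_val m x \in [:: 4; 5].
Proof.
by case: x => [[[j|j]|k]|] //= _; rewrite ltnNge => /negPf->; case: ifP.
Qed.

Lemma spoke_index_le x : spoke_index x <= i.
Proof. by case: x => [[[j|j]|k]|] //=; rewrite -ltnS. Qed.

Lemma tri_edge_axis x y z : tri_edge x y z ->
  [|| [&& x \in [:: 0; 3], y \notin [:: 0; 3] & z \notin [:: 0; 3]],
      [&& y \in [:: 0; 3], z \notin [:: 0; 3] & x \notin [:: 0; 3]]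
    | [&& z \in [:: 0; 3], x \notin [:: 0; 3] & y \notin [:: 0; 3]]].
Proof.
move=> /and4P[xy xz yz /or3P[]]; rewrite /= => /and4P[];
rewrite !inE => /or3P[]/eqP ex /or3P[]/eqP ey /or3P[]/eqP ez _;
by move: xy xz yz; rewrite ex ey ez.
Qed.

Lemma tri_edge_cross x y z : x \in [:: 0; 3] -> y \in [:: 1; 2] ->
  z \in [:: 4; 5] -> tri_edge x y z -> [/\ x = 3, y = 2 & z = 4].
Proof. by rewrite !inE; do 3 (case/orP => /eqP->). Qed.

(** The only hyperedge through 3 has labels 2, 3, 4, which takes just one label from the pair 1, 2
    and one from the pair 4, 5; [a] selects the pair. *)
Lemma tri_edge_same a x y z : a \in [:: 1; 4] -> y \in [:: a; a.+1] ->
  z \in [:: a; a.+1] -> tri_edge x y z -> x != 3.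
Proof.
by rewrite !inE => /orP[]/eqP-> /orP[]/eqP-> /orP[]/eqP->;
  apply: contraL => /eqP->.
Qed.

Lemma cut_reflect_ordered u v w : 0 < i -> axial u -> ~~ axial v -> ~~ axial w ->
  spoke_index v <= spoke_index w ->
  (forall m : 'I_i, tri_edge (cut_val m u) (cut_val m v) (cut_val m w)) ->
  exists2 e, e \in fan_edges i & [&& u \in e, v \in e & w \in e].
Proof.
move=> i_gt0 ua va wa; rewrite leq_eqVlt => /orP[/eqP vw | vw] cutE.
  (* Same spoke: a rim midpoint [u] would go to 3 under the cut at its own side, while [v] and [w]
     stay together on one side of that cut. So [u] is the apex. *)
  case: u ua cutE => [[//|k]|] _ cutE.
    suff: cut_val k (Some (inr k)) != 3 by rewrite /= eqxx.
    have [wk|kw] := leqP (spoke_index w) k.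
      by apply: (@tri_edge_same 1) (cutE k); rewrite // near_val ?vw.
    by apply: (@tri_edge_same 4) (cutE k); rewrite // far_val ?vw.
  exists (fan_spoke (inord (spoke_index w))); first by rewrite inE imset_f.
  by rewrite !fan_spokeE /=;
    case: v va vw {cutE} => [[[a|a]|//]|//] _ /= vw;
    case: w wa vw => [[[b|b]|//]|//] _ /= vw;
    rewrite -!val_eqE /= inordK // vw eqxx.
have cross (m : 'I_i) : spoke_index v <= m < spoke_index w ->
    [/\ cut_val m u = 3, cut_val m v = 2 & cut_val m w = 4].
  move=> /andP[vm mw]; apply: tri_edge_cross (cutE m).
  - by rewrite -axial_val.
  - exact: near_val.
  - exact: far_val.
have wi := spoke_index_le w.
(* The two extreme cuts between the spokes, at [spoke_index v] and [(spoke_index w).-1], both send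
   [u] to 3. So [u] is the midpoint of both cut sides, the spokes are consecutive, and the labels 2
   and 4 make [v] and [w] rim corners. *)
have lo_i : spoke_index v < i by lia.
have hi_i : (spoke_index w).-1 < i by lia.
have [|u1 v1 _] := cross (Ordinal lo_i); first by rewrite /= leqnn.
have [|u2 _ w2] := cross (Ordinal hi_i); first by rewrite /=; lia.
case: u ua u1 u2 {cutE cross} => [[//|k]|//] _ /=.
case: eqP => // kv _; case: eqP => // kw _.
exists (fan_side k); first by rewrite inE imset_f ?orbT.
rewrite !fan_sideE eqxx /=.
move: va wa v1 w2 kv kw vw => /=; clear.
case: v => [[[a|a]|//]|//] _; case: w => [[[b|b]|//]|//] _ /=;
  rewrite ?leqnn ?subnn //= => _ + kv kw ab; rewrite -kv eqxx.
- by move=> _; lia.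
- by rewrite ifF ?ifF; lia.
Qed.

(** The first cut already shows that the three vertices are distinct and which of them is axial; a
    cyclic rotation, and a swap if needed, reduces to the ordered case. *)
Lemma cut_reflect u v w : 0 < i ->
  (forall m, [set cut m u; cut m v; cut m w] \in hyperedges triangle) ->
  [set u; v; w] \in hyperedges (fan i).
Proof.
move=> i_gt0 cutE; pose m0 := Ordinal i_gt0.
have neq x y : cut m0 x != cut m0 y -> x != y by apply: contra_neq => ->.
have /hyperedge3P[/neq uv /neq uw /neq vw _] := cutE m0.
apply/hyperedge3P; split=> //; clear uv uw vw neq.
have valE m x y z : [set cut m x; cut m y; cut m z] \in hyperedges triangle ->
    tri_edge (cut_val m x) (cut_val m y) (cut_val m z).
  by rewrite -tri_edgeP ?cut_val_lt.
have ordered x y z :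
    [&& axial x, ~~ axial y & ~~ axial z] ->
    (forall m, [set cut m x; cut m y; cut m z] \in hyperedges triangle) ->
    exists2 e, e \in fan_edges i & [&& x \in e, y \in e & z \in e].
  move=> /and3P[xa ya za] xyz.
  have [yz|/ltnW zy] := leqP (spoke_index y) (spoke_index z).
    by apply: cut_reflect_ordered => // m; exact: valE.
  have [m|e eE /and3P[xe ze ye]] := cut_reflect_ordered i_gt0 xa za ya zy.
    by apply: valE; rewrite setUAC.
  by exists e; rewrite ?xe ?ye.
have := tri_edge_axis (valE _ _ _ _ (cutE m0)); rewrite -!axial_val => /or3P[] axs.
- exact: ordered axs cutE.
- have [m|e eE /and3P[ve we ue]] := ordered _ _ _ axs; first by rewrite -rot3.
  by exists e; rewrite ?ue ?ve.
- have [m|e eE /and3P[we ue ve]] := ordered _ _ _ axs; first by rewrite rot3.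
  by exists e; rewrite ?ue ?ve.
Qed.

End FanCut.

(** * The triangle inside a fan, and equality of the varieties *)

Definition fan_of_tri i (x : vertex triangle) : vertex (fan i.+1) :=
  match val x with
  | 0 => apex _
  | 1 => spoke_mid ord0
  | 2 => rim ord0
  | 3 => rim_mid ord0
  | 4 => rim (lift ord0 ord0)
  | _ => spoke_mid (lift ord0 ord0)
  end.

(** The first two spokes are adjacent to the first cut, at distance 0, so their labels are not
    flipped. *)
Lemma fan_of_triK i : cancel (@fan_of_tri i) (cut ord0).
Proof.
move=> x; apply: val_inj; rewrite /= inordK ?cut_val_lt //.
by case: x => -[|[|[|[|[|[|]]]]]] // lt_x6; rewrite /fan_of_tri /=.
Qed.

Lemma fan_of_tri_hom i : hypergraph_hom (@fan_of_tri i).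
Proof.
have spokeE j : fan_spoke j \in fan_edges i.+1 by rewrite inE imset_f.
have sideE k : fan_side k \in fan_edges i.+1 by rewrite inE imset_f ?orbT.
move=> e; rewrite [hyperedges _]/= !in_setU !in_set1 => /orP[/orP[]|] /eqP ->;
  rewrite imset3 /fan_of_tri /= !inordK //= -in_setU.
- exact: spokeE.
- have := sideE ord0; rewrite /fan_side.
  suff -> : widen_ord (leqnSn i.+1) ord0 = ord0 by [].
  exact: val_inj.
- by have := spokeE (lift ord0 ord0); rewrite /fan_spoke setUAC (@rot3 (fan i.+1)).
Qed.

Theorem proposition4p4 (i : nat) (hi : 1 <= i) :
  forall T : semiring,
    variety (hypergraph_semiring (fan i)) T <->
    variety (hypergraph_semiring triangle) T.
Proof.
have fan_tri : variety (model_semiring triangle) (model_semiring (fan i)).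
  apply: (@variety_reflecting_family (fan i) triangle _ (Ordinal hi) (@cut i)).
    exact: cut_hom.
  by move=> u v w; exact: cut_reflect.
have tri_fan : variety (model_semiring (fan i)) (model_semiring triangle).
  case: i hi {fan_tri} => // i _.
  apply: (@variety_reflecting_family _ _ unit tt (fun _ => @fan_of_tri i)).
    by move=> _; exact: fan_of_tri_hom.
  (* One map is enough: the first cut is a homomorphism that undoes it, so it carries hyperedges
     among the images back to the triangle. *)
  move=> u v w /(_ tt) /(hypergraph_hom3 (@cut_hom i.+1 ord0)).
  by rewrite !fan_of_triK.
have TF := variety_trans (variety_hypergraph (H := triangle) (tri 0))
  (variety_trans fan_tri (@variety_model (fan i))).
have FT := variety_trans (variety_hypergraph (H := fan i) (apex i))
  (variety_trans tri_fan (@variety_model triangle)).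
by move=> T; split; [exact: variety_trans TF|exact: variety_trans FT].
Qed.
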